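(* Let $f,g$ be spatial discretizations with $\frac{dq}{dt}=f(q)+g(q)$ on $V_h$, let $q_n\in V_h$ and $\Delta t>0$, and let $Q_{n,1},\dots,Q_{n,s},q_{n+1}\in V_h$ satisfy the $s$-stage IMEX Runge--Kutta relations $$Q_{n,i}=q_n+\Delta t\sum_{j=1}^{i-1}a_{ij}f_j+\Delta t\sum_{j=1}^{i}\tilde a_{ij}g_j\quad(i=1,\dots,s),\qquad q_{n+1}=q_n+\Delta t\sum_{i=1}^s b_if_i+\Delta t\sum_{i=1}^s\tilde b_ig_i,$$ where $f_i=f(t_n+c_i\Delta t,Q_{n,i})$, $g_i=g(t_n+\tilde c_i\Delta t,Q_{n,i})$, and $b_i\ge 0$, $\tilde b_i\ge 0$ for all $i$. For $\gamma>0$ put $$q_{n+\gamma}=q_n+\gamma\Delta t\sum_{i=1}^s\left(b_if_i+\tilde b_ig_i\right)=\gamma q_{n+1}+(1-\gamma)q_n .$$ Suppose that $\gamma>0$ satisfies $$\eta(q_{n+\gamma})-\eta(q_n)-\gamma\Delta t\sum_{i=1}^s\left(b_if_i+\tilde b_ig_i,\varphi_i\right)=0,\qquad \varphi_i=\varphi(Q_{n,i}).\qquad( * )$$ If $f$ and $g$ are both entropy-stable, then $\eta(q_{n+\gamma})\le\eta(q_n)$; if $f$ and $g$ are both entropy-conserving, then $\eta(q_{n+\gamma})=\eta(q_n)$. In particular, for the energy entropy $\eta(q)=\frac12\|q\|^2$ (so $\varphi(q)=q$) and $q_{n+1}\ne q_n$, the relaxation parameter (the nonzero solution $\gamma$ of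 $( * )$) is determined explicitly by $$\gamma=2\,\|q_{n+1}-q_n\|^{-2}\,\Delta t\sum_{i=1}^s\left(b_if_i+\tilde b_ig_i,\;Q_{n,i}-q_n\right).$$
   Context: $V_h$ is the finite-dimensional space of discontinuous piecewise polynomials on a mesh $\Omega_h$ of a one-dimensional domain, $(u,v)=\int_{\Omega_h}uv\,dx$ is the $L^2$ inner product and $\|u\|=(u,u)^{1/2}$. The system is a semi-discretization (method of lines) of a scalar conservation law with periodic or compactly supported boundary conditions. A convex differentiable scalar function $\eta$ is the entropy function, and $\varphi(q)=\frac{\partial\eta}{\partial q}(q)$ is the entropy variable. For $q\in V_h$, the expression $\eta(q)$ in comparisons between time levels denotes the total entropy $(\eta(q),1)=\int_{\Omega_h}\eta(q)\,dx$. The energy entropy is total entropy $\frac12\|q\|^2$, with entropy variable $\varphi(q)=q$. A spatial discretization $f$ is entropy-stable if $(f(t,q),\varphi(q))\le 0$ for all times $t$ and all states $q$, and entropy-conserving if $(f(t,q),\varphi(q))=0$ for all $t,q$; likewise for $g$. The real numbers $a_{ij},\tilde a_{ij},b_i,\tilde b_i,c_i,\tilde c_i$ are the coefficients of the IMEX Runge--Kutta scheme ($a$ explicit for $f$, $\tilde a$ diagonally implicit for $g$). The number $\gamma$ is the relaxation parameter and $q_{n+\gamma}$ approximates $q(t_n+\gamma\Delta t)$. *)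

(* Defs.v *)
From HB Require Import structures.
From mathcomp Require Import all_boot all_order all_algebra.
From mathcomp Require Import qpoly.
From mathcomp Require Import all_classical all_reals all_analysis.

Set Implicit Arguments.
Unset Strict Implicit.
Unset Printing Implicit Defensive.
Import Order.TTheory GRing.Theory Num.Theory.
Import numFieldNormedType.Exports.
Local Open Scope classical_set_scope.
Local Open Scope ring_scope.

Record mesh (R : realType) := Mesh {
  ncells : nat;
  node : 'I_ncells.+1 -> R;
  node_lt : forall k : 'I_ncells,
    node (widen_ord (leqnSn ncells) k) < node (lift ord0 k) }.

Definition cell (R : realType) (M : mesh R) (k : 'I_(ncells M)) : set R :=
  `[node (widen_ord (leqnSn (ncells M)) k), node (lift ord0 k)].

(* Functions on the mesh are given cell by cell, hence are two-valued at the
   interior nodes; this does not affect integrals. *)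
Definition broken_fun (R : realType) (M : mesh R) := 'I_(ncells M) -> R -> R.

Definition mesh_integral (R : realType) (M : mesh R) (u : broken_fun M) : R :=
  \sum_(k < ncells M) \int[lebesgue_measure]_(y in cell k) u k y.

Definition L2dot (R : realType) (M : mesh R) (u v : broken_fun M) : R :=
  mesh_integral (fun k y => u k y * v k y).

Definition L2norm (R : realType) (M : mesh R) (u : broken_fun M) : R :=
  Num.sqrt (L2dot u u).

(* V_h: on each cell an independent polynomial of degree at most p. *)
Definition dg_space (R : realType) (M : mesh R) (p : nat) :=
  {ffun 'I_(ncells M) -> {poly_p.+1 R}}.

Definition dg_eval (R : realType) (M : mesh R) (p : nat) (q : dg_space M p) :
  broken_fun M := fun k y => (q k : {poly R}).[y].

Definition compose (R : realType) (M : mesh R) (h : R -> R)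
  (u : broken_fun M) : broken_fun M := fun k y => h (u k y).

Definition is_entropy_function (R : realType) (eta : R -> R) : Prop :=
  convex_function [set: R^o] eta /\ forall u : R, derivable eta u 1.

(* phi(q); it is in general not an element of V_h. *)
Definition entropy_variable (R : realType) (M : mesh R) (p : nat)
  (eta : R -> R) (q : dg_space M p) : broken_fun M :=
  compose (derive1 eta) (dg_eval q).

Definition total_entropy (R : realType) (M : mesh R) (p : nat)
  (eta : R -> R) (q : dg_space M p) : R :=
  mesh_integral (compose eta (dg_eval q)).

Definition energy (R : realType) (u : R) : R := 2^-1 * u ^+ 2.

Definition entropy_stable (R : realType) (M : mesh R) (p : nat) (eta : R -> R)
  (f : R -> dg_space M p -> dg_space M p) : Prop :=
  forall t q, L2dot (dg_eval (f t q)) (entropy_variable eta q) <= 0.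

Definition entropy_conserving (R : realType) (M : mesh R) (p : nat)
  (eta : R -> R) (f : R -> dg_space M p -> dg_space M p) : Prop :=
  forall t q, L2dot (dg_eval (f t q)) (entropy_variable eta q) = 0.

(* The fields named ex* belong to the explicit part (f), those named im* to the
   diagonally implicit part (g). Entries of exA on or above the diagonal and of
   imA above it are never used. *)
Record imex_tableau (R : realType) (s : nat) := ImexTableau {
  exA : 'M[R]_s; imA : 'M[R]_s;
  exb : 'I_s -> R; imb : 'I_s -> R;
  exc : 'I_s -> R; imc : 'I_s -> R }.

Definition ex_stage (R : realType) (M : mesh R) (p s : nat)
  (T : imex_tableau R s) (f : R -> dg_space M p -> dg_space M p) (t dt : R)
  (Q : 'I_s -> dg_space M p) (i : 'I_s) : dg_space M p :=
  f (t + exc T i * dt) (Q i).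

Definition im_stage (R : realType) (M : mesh R) (p s : nat)
  (T : imex_tableau R s) (g : R -> dg_space M p -> dg_space M p) (t dt : R)
  (Q : 'I_s -> dg_space M p) (i : 'I_s) : dg_space M p :=
  g (t + imc T i * dt) (Q i).

Definition imex_stages (R : realType) (M : mesh R) (p s : nat)
  (T : imex_tableau R s) (f g : R -> dg_space M p -> dg_space M p) (t dt : R)
  (qn : dg_space M p) (Q : 'I_s -> dg_space M p) : Prop :=
  forall i : 'I_s, Q i = qn
    + dt *: (\sum_(j < s | (j < i)%N) exA T i j *: ex_stage T f t dt Q j)
    + dt *: (\sum_(j < s | (j <= i)%N) imA T i j *: im_stage T g t dt Q j).

Definition imex_update (R : realType) (M : mesh R) (p s : nat)
  (T : imex_tableau R s) (f g : R -> dg_space M p -> dg_space M p) (t dt : R)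
  (qn : dg_space M p) (Q : 'I_s -> dg_space M p) (qn1 : dg_space M p) : Prop :=
  qn1 = qn
    + dt *: (\sum_(i < s) exb T i *: ex_stage T f t dt Q i)
    + dt *: (\sum_(i < s) imb T i *: im_stage T g t dt Q i).

(* b_i f_i + ~b_i g_i *)
Definition weighted_rhs (R : realType) (M : mesh R) (p s : nat)
  (T : imex_tableau R s) (f g : R -> dg_space M p -> dg_space M p) (t dt : R)
  (Q : 'I_s -> dg_space M p) (i : 'I_s) : dg_space M p :=
  exb T i *: ex_stage T f t dt Q i + imb T i *: im_stage T g t dt Q i.

(* q_{n+gamma} *)
Definition relaxed_update (R : realType) (M : mesh R) (p s : nat)
  (T : imex_tableau R s) (f g : R -> dg_space M p -> dg_space M p) (t dt : R)
  (qn : dg_space M p) (Q : 'I_s -> dg_space M p) (gamma : R) : dg_space M p :=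
  qn + (gamma * dt) *: \sum_(i < s) weighted_rhs T f g t dt Q i.

Definition relaxation_condition (R : realType) (M : mesh R) (p s : nat)
  (eta : R -> R)
  (T : imex_tableau R s) (f g : R -> dg_space M p -> dg_space M p) (t dt : R)
  (qn : dg_space M p) (Q : 'I_s -> dg_space M p) (gamma : R) : Prop :=
  total_entropy eta (relaxed_update T f g t dt qn Q gamma)
    - total_entropy eta qn
    - gamma * dt * \sum_(i < s)
        L2dot (dg_eval (weighted_rhs T f g t dt Q i))
              (entropy_variable eta (Q i))
  = 0.

(* Main.v *)
Require Import Defs.
From HB Require Import structures.
From mathcomp Require Import all_boot all_order all_algebra.
From mathcomp Require Import qpoly.
From mathcomp Require Import all_classical all_reals all_analysis.
From mathcomp Require Import ring lra.

(** The relaxation condition says that the total entropy changes over the relaxed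
    step by exactly [gamma dt] times a combination, with the weights [b_i] and
    [~b_i], of the products [(f_i, phi_i)] and [(g_i, phi_i)]. Each of these
    products is the entropy production of [f] or [g] at the state [Q_i], so it is
    nonpositive (or zero) when [f] and [g] are entropy-stable (or conserving), and
    the sign passes to the sum because the weights are nonnegative.

    Splitting [(b_i f_i + ~b_i g_i, phi_i)] into these products requires
    linearity of the integral, hence integrability of a polynomial times
    [eta' o q]. A differentiable convex [eta] has a nondecreasing derivative
    ([convex_derive1_nondecreasing]), so [eta' o q] is bounded and measurable on
    each cell ([entropy_variable_bounded_measurable]).

    For the energy, put [d = qn1 - qn = dt sum_i w_i] with
    [w_i = b_i f_i + ~b_i g_i]. Expanding [||qn + gamma d||^2]
    ([L2dot_sqrDZ]) turns the relaxation condition into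
    [gamma (qn, d) + gamma^2 ||d||^2 / 2 = gamma dt sum_i (w_i, Q_i)], and
    [(qn, d) = dt sum_i (w_i, qn)]. Dividing by [gamma ||d||^2 / 2] gives the
    formula; the norm of [d] is nonzero because a piecewise polynomial with zero
    square integral is zero ([L2dot_eq0]). *)

Set Implicit Arguments.
Unset Strict Implicit.
Unset Printing Implicit Defensive.
Import Order.TTheory GRing.Theory Num.Theory.
Import numFieldNormedType.Exports.
Local Open Scope classical_set_scope.
Local Open Scope ring_scope.

(** * Convexity of the entropy *)

Section ConvexDerivative.
Context {R : realType}.
Implicit Types (eta : R -> R) (x y : R).

(** The chord inequality at [x + h (y - x)], divided by [h > 0], bounds the
    difference quotients in direction [y - x] by [eta y - eta x]; the bound
    passes to the limit. The two signs of [y - x] are treated at once. *)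
Lemma convex_tangent_line eta x y : is_entropy_function eta ->
  derive1 eta x * (y - x) <= eta y - eta x.
Proof.
move=> [cvx_eta deta]; have dx := deta x.
have diffx : differentiable (eta : R -> R^o) x by exact/derivable1_diffP.
(* The direction y - x absorbs its sign, so only h -> 0+ is needed below. *)
have -> : derive1 eta x * (y - x) = 'D_(y - x) (eta : R -> R^o) x.
  rewrite derive1E !deriveE//.
  rewrite -[in RHS](mulr1 (y - x)) -[(y - x) * 1]/((y - x) *: (1 : R^o)).
  by rewrite linearZ mulrC.
have dyx : cvg (h^-1 *: ((eta (h *: (y - x) + x) - eta x) : R^o) @[h --> 0^']).
  exact: (@diff_derivable _ _ _ (eta : R -> R^o) x (y - x)).
rewrite /derive /= cvg_at_rightE//; apply: limr_le.
  by apply/cvg_ex; eexists; apply: cvg_dnbhs_at_right; exact: dyx.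
near=> h.
have h0 : 0 < h by near: h; exact: nbhs_right_gt.
have h1 : h <= 1 by near: h; apply: nbhs_right_le.
rewrite /GRing.scale /= mulrC ler_pdivrMr//.
pose t : {i01 R} := Itv01 (ltW h0) h1.
have convE : conv t (y : convex_lmodType R^o) x = h * (y - x) + x :> R.
  by rewrite -[LHS]/(h * y + (1 - h) * x); ring.
have := cvx_eta t y x (in_setT _) (in_setT _).
rewrite convE -[X in _ <= X -> _]/(h * eta y + (1 - h) * eta x) => le_chord.
rewrite lerBlDr (le_trans le_chord)//.
by rewrite le_eqVlt; apply/orP; left; apply/eqP; ring.
Unshelve. all: by end_near.
Qed.

(** Adding the tangent-line inequalities at [x] and at [y] leaves
    [(eta' y - eta' x) (y - x) >= 0]. *)
Lemma convex_derive1_nondecreasing eta : is_entropy_function eta ->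
  nondecreasing_fun (derive1 eta).
Proof.
move=> eta_ent x y; rewrite le_eqVlt => /orP[/eqP->//|xy].
have := convex_tangent_line x y eta_ent.
have := convex_tangent_line y x eta_ent.
rewrite -[x - y]opprB mulrN -subr_gt0 in xy * => tany tanx.
rewrite -(ler_pM2r xy); lra.
Qed.

End ConvexDerivative.

Lemma is_derive_energy {R : realType} (x : R) : is_derive x 1 (@energy R) x.
Proof.
rewrite /energy; apply: is_derive_eq.
by rewrite /GRing.scale/=; field.
Qed.

Lemma derive1_energy {R : realType} : derive1 (@energy R) = id.
Proof.
apply/funext => x; rewrite derive1E.
by case: (is_derive_energy x).
Qed.

Lemma energy_entropy_function {R : realType} : is_entropy_function (@energy R).
Proof.
split=> [t x y _ _|x]; last by case: (is_derive_energy x).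
have chord (l a b : R) : 0 <= l -> 0 <= 1 - l ->
    energy (l * a + (1 - l) * b) <= l * energy a + (1 - l) * energy b.
  (* The gap in the convexity inequality is l (1 - l) (a - b)^2 / 2. *)
  move=> l0 l1; have := mulr_ge0 (mulr_ge0 l0 l1) (sqr_ge0 (a - b)).
  rewrite /energy => gap_ge0; lra.
by apply: (chord t%:num x y) => //; rewrite subr_ge0.
Qed.

(** * Integrability on the mesh

    The integral is linear only on integrable functions, and an entropy
    variable is in general not a piecewise polynomial. *)

Section BoundedMeasurable.
Context {R : realType} {M : mesh R}.
Implicit Types u v : broken_fun M.

(** Integrability on each cell would not be stable under products, which the
    inner product needs; boundedness and measurability are. *)
Definition bounded_measurable v := forall k : 'I_(ncells M),
  measurable_fun (cell k) (v k) /\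
  exists B, forall y, cell k y -> `|v k y| <= B.

Lemma measurable_cell (k : 'I_(ncells M)) :
  measurable (cell k : set (measurableTypeR R)).
Proof. exact: measurable_itv. Qed.

Lemma lebesgue_measure_cell (k : 'I_(ncells M)) :
  lebesgue_measure (cell k) =
  (node (lift ord0 k) - node (widen_ord (leqnSn (ncells M)) k))%:E.
Proof. by rewrite lebesgue_measure_itv/= lte_fin node_lt -EFinB. Qed.

Lemma bounded_measurableM u v : bounded_measurable u -> bounded_measurable v ->
  bounded_measurable (fun k y => u k y * v k y).
Proof.
move=> ub vb k; have [mu [B uB]] := ub k; have [mv [C vC]] := vb k; split.
  exact: measurable_realfun.measurable_funM.
by exists (B * C) => y ky; rewrite normrM ler_pM ?uB ?vC.
Qed.

Lemma bounded_measurable_integrable v k : bounded_measurable v ->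
  lebesgue_measure.-integrable (cell k) (EFin \o v k).
Proof.
move=> /(_ k)[mv [B vB]]; apply: measurable_bounded_integrable => //.
- exact: measurable_cell.
- exact: (eq_ind_r (fun z => z < +oo)%E (ltry _) (lebesgue_measure_cell k)).
- exists B; split; first exact: num_real.
  by move=> C BC y ky; exact: le_trans (vB y ky) (ltW BC).
Qed.

Lemma dg_eval_bounded_measurable p (q : dg_space M p) : bounded_measurable (dg_eval q).
Proof.
move=> k; split; first exact: measurable_poly.
have /compact_bounded[B [_ hB]] : compact (dg_eval q k @` cell k).
  apply: continuous_compact; last exact: segment_compact.
  by apply: continuous_subspaceT; exact: continuous_horner.
exists (B + 1) => y ky; apply: (hB (B + 1)); first by rewrite ltrDl.
by exists y.
Qed.

(** A monotone function is Borel, and on [-B, B] it lies between its end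
    values. *)
Lemma compose_nondecreasing_bounded_measurable (h : R -> R) v :
  nondecreasing_fun h -> bounded_measurable v -> bounded_measurable (compose h v).
Proof.
move=> hh vb k; have [mv [B vB]] := vb k; split.
  apply: (measurableT_comp _ mv).
  exact: measurable_realfun.nondecreasing_measurable.
exists (Num.max `|h (- B)| `|h B|) => y /vB; rewrite ler_norml => /andP[Bl Bu].
rewrite /compose le_max; have := hh _ _ Bl; have := hh _ _ Bu.
have [h0|h0] := lerP 0 (h (v k y)) => hu hl.
  by rewrite (ger0_norm h0) (le_trans hu (ler_norm _)) orbT.
by rewrite (ltr0_norm h0) -normrN (le_trans _ (ler_norm _))// lerN2.
Qed.

Lemma entropy_variable_bounded_measurable p (eta : R -> R) (q : dg_space M p) :
  is_entropy_function eta -> bounded_measurable (entropy_variable eta q).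
Proof.
move=> eta_ent; apply: compose_nondecreasing_bounded_measurable;
  last exact: dg_eval_bounded_measurable.
exact: convex_derive1_nondecreasing.
Qed.

Lemma mesh_integral_linear a u v : bounded_measurable u -> bounded_measurable v ->
  mesh_integral (fun k y => a * u k y + v k y) =
  a * mesh_integral u + mesh_integral v.
Proof.
move=> ub vb; rewrite /mesh_integral mulr_sumr -big_split/=.
apply: eq_bigr => k _; have mk := measurable_cell k.
have iu := bounded_measurable_integrable k ub.
have iv := bounded_measurable_integrable k vb.
rewrite -(RintegralZl a mk iu) -(RintegralD mk _ iv)//.
exact: (integrableZl mk a iu).
Qed.

End BoundedMeasurable.

(** * The inner product on the polynomial space *)

(** A nonzero polynomial has finitely many roots, and a set of positive measure
    cannot be covered by a null set and finitely many points. *)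
Lemma ae_eq0_poly_eq0 {R : realType} (P : {poly R}) (D : set R) : measurable D ->
  (0 < lebesgue_measure D)%E ->
  ae_eq lebesgue_measure D (EFin \o horner P) (cst 0%E) -> P = 0.
Proof.
move=> mD D0 aeP; apply/eqP/negPn/negP => P0.
have finP : finite_set [set y | root P y].
  apply: contrapT => /(infinite_set_fset (size P))[B BP sizeP].
  have rootB : all (root P) (finmap.enum_fset B) by apply/allP => y /BP.
  have := max_poly_roots P0 rootB (finmap.fset_uniq B).
  by rewrite ltnNge sizeP.
have rootsN : lebesgue_measure.-negligible [set y | root P y].
  exists [set y | root P y]; split=> //.
  - exact: countable_measurable (finite_set_countable finP).
  - exact: countable_lebesgue_measure0 (finite_set_countable finP).
have /negligibleP : lebesgue_measure.-negligible D.
  apply: negligibleS (negligibleU aeP rootsN) => y Dy.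
  have [ry|nry] := pselect (root P y); [by right|left => /(_ Dy)[Py]].
  by apply: nry; exact/eqP.
by move=> /(_ mD) D_eq0; move: D0; rewrite D_eq0 ltxx.
Qed.

Section L2Form.
Context {R : realType} {M : mesh R} {p : nat}.
Implicit Types (q r : dg_space M p) (v : broken_fun M).

Lemma L2dotC u v : @L2dot R M u v = L2dot v u.
Proof.
by congr mesh_integral; apply/funext => k; apply/funext => y; rewrite mulrC.
Qed.

Lemma dg_eval_linear a q r k y :
  dg_eval (a *: q + r) k y = a * dg_eval q k y + dg_eval r k y.
Proof. by rewrite /dg_eval !ffunE /= hornerD hornerZ. Qed.

Lemma L2dot_linearl a q r v : bounded_measurable v ->
  L2dot (dg_eval (a *: q + r)) v = a * L2dot (dg_eval q) v + L2dot (dg_eval r) v.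
Proof.
move=> vb; rewrite /L2dot -mesh_integral_linear; first last.
- by apply: bounded_measurableM => //; exact: dg_eval_bounded_measurable.
- by apply: bounded_measurableM => //; exact: dg_eval_bounded_measurable.
congr mesh_integral; apply/funext => k; apply/funext => y.
by rewrite dg_eval_linear mulrDl mulrA.
Qed.

Lemma L2dot0l v : bounded_measurable v -> L2dot (dg_eval (0 : dg_space M p)) v = 0.
Proof.
by move=> vb; have := L2dot_linearl 1 0 0 vb; rewrite scaler0 addr0; lra.
Qed.

Lemma L2dotZl a q v : bounded_measurable v ->
  L2dot (dg_eval (a *: q)) v = a * L2dot (dg_eval q) v.
Proof. by move=> vb; have := L2dot_linearl a q 0 vb; rewrite L2dot0l// !addr0. Qed.

Lemma L2dotDl q r v : bounded_measurable v ->
  L2dot (dg_eval (q + r)) v = L2dot (dg_eval q) v + L2dot (dg_eval r) v.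
Proof. by move=> vb; have := L2dot_linearl 1 q r vb; rewrite scale1r mul1r. Qed.

Lemma L2dot_suml (I : finType) (F : I -> dg_space M p) v : bounded_measurable v ->
  L2dot (dg_eval (\sum_i F i)) v = \sum_i L2dot (dg_eval (F i)) v.
Proof.
move=> vb; apply: (big_morph (fun q => L2dot (dg_eval q) v)).
- by move=> q r; exact: L2dotDl.
- exact: L2dot0l.
Qed.

Lemma L2dotBr v q r : bounded_measurable v ->
  L2dot v (dg_eval (q - r)) = L2dot v (dg_eval q) - L2dot v (dg_eval r).
Proof.
by move=> vb; rewrite !(L2dotC v) L2dotDl// -scaleN1r L2dotZl// mulN1r.
Qed.

Lemma L2dot_sqrDZ a q r :
  L2dot (dg_eval (q + a *: r)) (dg_eval (q + a *: r)) =
  L2dot (dg_eval q) (dg_eval q) + 2 * a * L2dot (dg_eval r) (dg_eval q)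
  + a ^+ 2 * L2dot (dg_eval r) (dg_eval r).
Proof.
have qb := dg_eval_bounded_measurable; rewrite L2dotDl// L2dotZl//.
rewrite ![L2dot _ (dg_eval (_ + _))]L2dotC !L2dotDl// !L2dotZl//.
by rewrite [L2dot (dg_eval q) (dg_eval r)]L2dotC; ring.
Qed.

Lemma L2dot_ge0 v : 0 <= L2dot v v.
Proof.
by apply: sumr_ge0 => k _; apply: Rintegral_ge0 => y _; rewrite -expr2 sqr_ge0.
Qed.

(** This makes [qn1 <> qn] enough to divide by [||qn1 - qn||^2]. The cells have
    positive length, so a zero square integral forces each local polynomial to
    vanish. *)
Lemma L2dot_eq0 q : L2dot (dg_eval q) (dg_eval q) = 0 -> q = 0.
Proof.
move=> /eqP; rewrite psumr_eq0; last first.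
  by move=> k _; apply: Rintegral_ge0 => y _; rewrite -expr2 sqr_ge0.
move=> /allP q0; apply/ffunP => k; rewrite ffunE; apply/val_inj => /=.
have mk := measurable_cell k.
have /eqP := implyP (q0 k (mem_index_enum k)) isT.
have sqb := bounded_measurableM (dg_eval_bounded_measurable q)
  (dg_eval_bounded_measurable q).
have iq := bounded_measurable_integrable k sqb.
move=> int0; apply: (@ae_eq0_poly_eq0 _ _ (cell k)) => //.
  by rewrite lebesgue_measure_cell lte_fin subr_gt0 node_lt.
have /integrableP[mq2 _] := iq.
have /(ae_eq_integral_abs lebesgue_measure mk mq2) :
  (\int[lebesgue_measure]_(y in cell k) `|(dg_eval q k y * dg_eval q k y)%:E| = 0)%E.
  transitivity (\int[lebesgue_measure]_(y in cell k) (dg_eval q k y * dg_eval q k y)%:E)%E.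
    by apply: eq_integral => y _; rewrite /= ger0_norm// -expr2 sqr_ge0.
  by rewrite -[LHS]fineK ?integrable_fin_num// [fine _]int0.
apply: filterS => y sq0 /sq0 [/eqP]; rewrite mulf_eq0 orbb => /eqP qky0.
by congr EFin.
Qed.

Lemma L2norm_sqr v : L2norm v ^+ 2 = L2dot v v.
Proof. by rewrite sqr_sqrtr// L2dot_ge0. Qed.

Lemma total_energy_L2dot q :
  total_entropy (@energy R) q = 2^-1 * L2dot (dg_eval q) (dg_eval q).
Proof.
rewrite /total_entropy /L2dot /mesh_integral mulr_sumr.
apply: eq_bigr => k _.
have sqb := bounded_measurableM (dg_eval_bounded_measurable q)
  (dg_eval_bounded_measurable q).
exact: (RintegralZl _ (measurable_cell k) (bounded_measurable_integrable k sqb)).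
Qed.

Lemma total_energyE q :
  total_entropy (@energy R) q = 2^-1 * L2norm (dg_eval q) ^+ 2.
Proof. by rewrite L2norm_sqr total_energy_L2dot. Qed.

Lemma entropy_variable_energy q : entropy_variable (@energy R) q = dg_eval q.
Proof. by rewrite /entropy_variable derive1_energy. Qed.

End L2Form.

(** * The relaxed Runge-Kutta step *)

Section Relaxation.
Context {R : realType} {M : mesh R} {p s : nat} (T : imex_tableau R s).
Context (f g : R -> dg_space M p -> dg_space M p) (t dt : R).
Context (qn : dg_space M p) (Q : 'I_s -> dg_space M p).

Lemma imex_updateE qn1 : imex_update T f g t dt qn Q qn1 ->
  qn1 - qn = dt *: \sum_(i < s) weighted_rhs T f g t dt Q i.
Proof.
move=> ->; rewrite /weighted_rhs big_split/= scalerDr.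
by rewrite -[qn + _ + _]addrA [LHS]addrC addKr.
Qed.

Lemma L2dot_weighted_rhs i v : bounded_measurable v ->
  L2dot (dg_eval (weighted_rhs T f g t dt Q i)) v =
  exb T i * L2dot (dg_eval (ex_stage T f t dt Q i)) v +
  imb T i * L2dot (dg_eval (im_stage T g t dt Q i)) v.
Proof. by move=> vb; rewrite /weighted_rhs L2dotDl// !L2dotZl. Qed.

End Relaxation.

Theorem proposition2p1 (R : realType) (M : mesh R) (p s : nat)
  (T : imex_tableau R s) (f g : R -> dg_space M p -> dg_space M p)
  (tn dt : R) (qn qn1 : dg_space M p) (Q : 'I_s -> dg_space M p)
  (dt_gt0 : 0 < dt)
  (stages : imex_stages T f g tn dt qn Q)
  (update : imex_update T f g tn dt qn Q qn1)
  (exb_ge0 : forall i, 0 <= exb T i)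
  (imb_ge0 : forall i, 0 <= imb T i) :
  (forall gamma : R, 0 < gamma ->
     relaxed_update T f g tn dt qn Q gamma = gamma *: qn1 + (1 - gamma) *: qn)
  /\
  (forall (eta : R -> R) (gamma : R),
     is_entropy_function eta -> 0 < gamma ->
     relaxation_condition eta T f g tn dt qn Q gamma ->
     (entropy_stable eta f -> entropy_stable eta g ->
        total_entropy eta (relaxed_update T f g tn dt qn Q gamma)
          <= total_entropy eta qn)
     /\
     (entropy_conserving eta f -> entropy_conserving eta g ->
        total_entropy eta (relaxed_update T f g tn dt qn Q gamma)
          = total_entropy eta qn))
  /\
  (is_entropy_function (@energy R)
   /\ (forall q : dg_space M p,
         total_entropy (@energy R) q = 2^-1 * L2norm (dg_eval q) ^+ 2)
   /\ (forall q : dg_space M p,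
         entropy_variable (@energy R) q = dg_eval q)
   /\ (qn1 <> qn ->
       forall gamma : R, gamma <> 0 ->
         (relaxation_condition (@energy R) T f g tn dt qn Q gamma <->
          gamma = 2 * L2norm (dg_eval (qn1 - qn)) ^- 2 * dt *
            \sum_(i < s) L2dot (dg_eval (weighted_rhs T f g tn dt Q i))
                               (dg_eval (Q i - qn))))).
Proof.
have incr := imex_updateE update.
have polyb := @dg_eval_bounded_measurable R M p.
have relaxedE gamma :
    relaxed_update T f g tn dt qn Q gamma = qn + gamma *: (qn1 - qn).
  by rewrite incr scalerA.
split; [|split; [|split; [|split; [|split]]]].
- by move=> gamma _; rewrite relaxedE scalerBr scalerBl scale1r addrCA.
- move=> eta gamma eta_ent gamma0 /eqP; rewrite subr_eq0 subr_eq => /eqP ->.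
  have phib i := entropy_variable_bounded_measurable (Q i) eta_ent.
  split=> [fs gs|fc gc].
    rewrite gerDr pmulr_rle0 ?mulr_gt0// sumr_le0// => i _.
    rewrite L2dot_weighted_rhs// -[0]addr0 lerD//.
      by rewrite mulr_ge0_le0// fs.
    by rewrite mulr_ge0_le0// gs.
  rewrite big1 ?mulr0 ?add0r// => i _.
  by rewrite L2dot_weighted_rhs// fc gc !mulr0 addr0.
- exact: energy_entropy_function.
- exact: total_energyE.
- exact: entropy_variable_energy.
move=> qn1_neq gamma gamma0.
have N0 : L2dot (dg_eval (qn1 - qn)) (dg_eval (qn1 - qn)) != 0.
  by apply/eqP => /L2dot_eq0/eqP; rewrite subr_eq0 => /eqP.
have dq : L2dot (dg_eval (qn1 - qn)) (dg_eval qn) =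
    dt * \sum_i L2dot (dg_eval (weighted_rhs T f g tn dt Q i)) (dg_eval qn).
  by rewrite incr L2dotZl// L2dot_suml.
rewrite /relaxation_condition relaxedE.
rewrite !total_energy_L2dot (L2norm_sqr (dg_eval (qn1 - qn))).
rewrite L2dot_sqrDZ dq.
under [X in _ - gamma * dt * X]eq_bigr do rewrite entropy_variable_energy.
under [in X in _ <-> X]eq_bigr do rewrite L2dotBr//.
rewrite sumrB.
move: N0; set N := L2dot _ _; set A := L2dot _ _.
set Sn := \sum_i _; set SQ := \sum_i _ => N0.
(* Besides gamma = 0, the quadratic in gamma has exactly one other root. *)
have -> : 2^-1 * (A + 2 * gamma * (dt * Sn) + gamma ^+ 2 * N) - 2^-1 * A
    - gamma * dt * SQ = 2^-1 * gamma * N * (gamma - 2 / N * dt * (SQ - Sn)).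
  by field.
split=> [/eqP|->]; last by rewrite subrr mulr0.
rewrite !mulf_eq0 invr_eq0 pnatr_eq0 (negbTE N0) (introF eqP gamma0) subr_eq0.
by move/eqP.
Qed.
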